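(* Let $c_{m,n}$, $R_m=c_{m,m+1}/\alpha$, $d_{m,n}$ and $S_m$ be as defined in the context, and let $\ell_\alpha=1-\alpha+\alpha\ell$. For all $\ell\in(0,1]$, $\alpha\in[\frac12,1]$, and integers $0\le m<n$, we have $$0\le c_{m,n}-d_{m,n}\le(1-\alpha)^2(m+1)\,\ell_\alpha^{\,m}.$$ For $n=m+1$ one has $d_{m,m+1}=\alpha\big[\pi_0^m+\sum_{i=1}^m\pi_i^m\,\ell\,d_{i-1,m}\big]=\alpha\,S_m$, and therefore $$R_m-S_m\le(1-\alpha)^2(m+1)\,\ell_\alpha^{\,m}/\alpha .$$
   Context: Weights: for integers $m\ge0$, $\pi_0^m=(1-\alpha)^m$ and $\pi_i^m=\alpha(1-\alpha)^{m-i}$ for $1\le i\le m$ (with $0^0=1$), so $\sum_{i=0}^m\pi_i^m=1$. The quantities $c_{m,n}$ for $0\le m\le n$ are defined by the recursion $$c_{m,n}=\pi_0^m-\pi_0^n+\sum_{i=1}^m\sum_{j=m+1}^n\ell\,\pi_i^m\pi_j^n\,c_{i-1,j-1}$$ (so $c_{n,n}=0$ and $c_{0,n}=1-\pi_0^n$). The quantities $d_{m,n}$ are defined by recursive optimal transport: $d_{-1,-1}=0$, $d_{-1,n}=d_{n,-1}=1/\ell$ for all integers $n\ge0$, and for all integers $m,n\ge0$ $$d_{m,n}=\min_{z\in\mathcal F_{m,n}}\sum_{i=0}^m\sum_{j=0}^n z_{i,j}\,\ell\,d_{i-1,j-1},$$ where $\mathcal F_{m,n}$ is the set of arrays $z=(z_{i,j})_{0\le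 i\le m,\,0\le j\le n}$ with $z_{i,j}\ge0$, $\sum_{j=0}^n z_{i,j}=\pi_i^m$ for $0\le i\le m$, and $\sum_{i=0}^m z_{i,j}=\pi_j^n$ for $0\le j\le n$. Finally, $S_m=\sum_{i=0}^m\pi_i^m\,\ell\,d_{i-1,m}$. *)

(* Defs.v *)
From HB Require Import structures.
From mathcomp Require Import all_boot all_order all_algebra.
From mathcomp Require Import all_classical all_reals all_analysis.
From mathcomp Require Import ring lra zify.
Import Order.TTheory GRing.Theory Num.Theory.
Import numFieldNormedType.Exports.

Set Implicit Arguments.
Unset Strict Implicit.
Unset Printing Implicit Defensive.

Local Open Scope classical_set_scope.
Local Open Scope ring_scope.

Section Weights.
Context {R : realType}.
Implicit Types (a : R) (m i : nat).

(** The weight $\pi_i^m$; only its values for $i \le m$ are used. *)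
Definition wt a m i : R :=
  if i is 0%N then (1 - a) ^+ m else a * (1 - a) ^+ (m - i).

Lemma wtS a m i : (i <= m)%N -> wt a m.+1 i = (1 - a) * wt a m i.
Proof.
case: i => [|i] im /=; first by rewrite exprS.
by rewrite subSn // exprS mulrCA.
Qed.

Lemma sum_wt a m : \sum_(i < m.+1) wt a m i = 1.
Proof.
elim: m => [|m IH]; first by rewrite big_ord1 /= expr0.
rewrite big_ord_recr /= subnn expr0 mulr1.
under eq_bigr => i _ do rewrite (@wtS a m i (ltn_ord i)).
by rewrite -mulr_sumr IH mulr1 subrK.
Qed.

Lemma wt_ge0 a m i : 0 <= a <= 1 -> 0 <= wt a m i.
Proof.
move=> /andP[a0 a1]; have b0 : 0 <= 1 - a by rewrite subr_ge0.
by case: i => [|i] /=; rewrite ?mulr_ge0 ?exprn_ge0.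
Qed.

End Weights.

Section Bounds.
Context {R : realType}.
Variables l a : R.
Implicit Types (k m n : nat).

(** The first index strictly decreases in the recursion, so [m.+1] units of
    fuel suffice to compute $c_{m,n}$; see [cval_rec]. *)
Fixpoint cfuel k m n : R :=
  if k is k'.+1 then
    wt a m 0 - wt a n 0
    + \sum_(1 <= i < m.+1) \sum_(m.+1 <= j < n.+1)
        l * wt a m i * wt a n j * cfuel k' i.-1 j.-1
  else 0.

Definition cval m n : R := cfuel m.+1 m n.

Lemma cfuelE k m n : (m < k)%N -> cfuel k m n = cval m n.
Proof.
suff H k1 k2 m' n' : (m' < k1)%N -> (m' < k2)%N ->
    cfuel k1 m' n' = cfuel k2 m' n' by move=> mk; exact: H.
elim: k1 k2 m' n' => [//|k1 IH] [//|k2] m' n' h1 h2 /=.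
congr (_ + _); apply: eq_big_nat => i /andP[i1 im]; apply: eq_bigr => j _.
by congr (_ * _); apply: IH; lia.
Qed.

Lemma cval_rec m n :
  cval m n = wt a m 0 - wt a n 0
    + \sum_(1 <= i < m.+1) \sum_(m.+1 <= j < n.+1)
        l * wt a m i * wt a n j * cval i.-1 j.-1.
Proof.
rewrite {1}/cval /=.
congr (_ + _); apply: eq_big_nat => i /andP[i1 im]; apply: eq_bigr => j _.
by congr (_ * _); apply: cfuelE; lia.
Qed.

Definition couplings m n : set 'M[R]_(m.+1, n.+1) :=
  [set z | [/\ forall i j, 0 <= z i j,
               forall i : 'I_m.+1, \sum_j z i j = wt a m i
             & forall j : 'I_n.+1, \sum_i z i j = wt a n j]].
Arguments couplings : clear implicits.

(** [D i j] stands for $d_{i-1,j-1}$. *)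
Definition transport_cost (D : nat -> nat -> R) m n (z : 'M[R]_(m.+1, n.+1)) : R :=
  \sum_(i < m.+1) \sum_(j < n.+1) z i j * (l * D i j).

(** Indices are shifted by one: [dfuel] computes $d_{M-1,N-1}$, so that index
    [0] encodes $-1$. The infimum is a minimum; see [dval_min]. *)
Fixpoint dfuel k M N : R :=
  match M, N with
  | 0%N, 0%N => 0
  | 0%N, _.+1 | _.+1, 0%N => l^-1
  | m.+1, n.+1 =>
      if k is k'.+1 then
        inf [set transport_cost (dfuel k') z | z in couplings m n]
      else 0
  end.

(** $d_{M-1,N-1}$ *)
Definition dpred M N : R := dfuel M M N.

(** $d_{m,n}$ for $m, n \ge 0$ *)
Definition dval m n : R := dpred m.+1 n.+1.

Lemma dfuelE k M N : (M <= k)%N -> dfuel k M N = dpred M N.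
Proof.
suff H k1 k2 M' N' : (M' <= k1)%N -> (M' <= k2)%N ->
    dfuel k1 M' N' = dfuel k2 M' N' by move=> mk; exact: H.
elim: k1 k2 M' N' => [|k1 IH] [|k2] [|m] [|n] //= h1 h2.
congr inf; apply: eq_imagel => z _.
apply: eq_bigr => i _; apply: eq_bigr => j _; congr (_ * (_ * _)).
by apply: IH; have := ltn_ord i; lia.
Qed.

Lemma dpred00 : dpred 0 0 = 0. Proof. by []. Qed.
Lemma dpred0S n : dpred 0 n.+1 = l^-1. Proof. by []. Qed.
Lemma dpredS0 n : dpred n.+1 0 = l^-1. Proof. by []. Qed.

Lemma dval_rec m n :
  dval m n = inf [set transport_cost dpred z | z in couplings m n].
Proof.
rewrite /dval {1}/dpred /=; congr inf; apply: eq_imagel => z _.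
apply: eq_bigr => i _; apply: eq_bigr => j _; congr (_ * (_ * _)).
by apply: dfuelE; have := ltn_ord i; lia.
Qed.

Lemma couplings_nonempty m n : 0 <= a <= 1 -> couplings m n !=set0.
Proof.
move=> a01; exists (\matrix_(i, j) (wt a m i * wt a n j)); split=> [i j|i|j].
- by rewrite mxE mulr_ge0 ?wt_ge0.
- under eq_bigr => j _ do rewrite mxE.
  by rewrite -mulr_sumr sum_wt mulr1.
- under eq_bigr => i _ do rewrite mxE.
  by rewrite -mulr_suml sum_wt mul1r.
Qed.

Lemma transport_cost_min D m n : 0 <= a <= 1 ->
  exists2 z, couplings m n z &
    forall w, couplings m n w -> transport_cost D z <= transport_cost D w.
Proof.
move=> a01.
pose N := (m.+1 * n.+1)%N.
have crd (i : 'I_m.+1) (j : 'I_n.+1) :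
    continuous (fun v : 'rV[R]_N => (vec_mx v : 'M[R]_(m.+1, n.+1)) i j).
  rewrite (_ : (fun v => _) = (fun v : 'rV[R]_N => v 0 (mxvec_index i j))).
    exact: coord_continuous.
  by apply/funext => v; rewrite mxE.
have ctsum (I : finType) (f : I -> 'rV[R]_N -> R) :
    (forall i, continuous (f i)) -> continuous (fun v => \sum_i f i v).
  move=> cf; apply: continuous_big => [|i _]; last exact: cf.
  exact: add_continuous.
pose A : set 'rV[R]_N := [set v | couplings m n (vec_mx v)].
have A0 : A !=set0.
  have [z zc] := (couplings_nonempty m n a01).
  by exists (mxvec z); rewrite /A /= mxvecK.
have cA : compact A.
  apply: bounded_closed_compact.
    exists 1; split; first exact: num_real.
    move=> M M1 v [v0 vr _]; rewrite /Num.norm /= mx_normrE.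
    apply: bigmax_le; first lra.
    move=> [i k] _ /=; rewrite ord1; case/mxvec_indexP: k => p q.
    rewrite -[v]vec_mxK mxvecE ger0_norm //.
    rewrite (le_trans _ (ltW M1)) //.
    have h : (vec_mx v : 'M[R]_(m.+1, n.+1)) p q <= wt a m p.
      by rewrite -vr (bigD1 q) //= lerDl sumr_ge0.
    apply: (le_trans h); rewrite -(sum_wt a m) (bigD1 p) //= lerDl.
    by apply: sumr_ge0 => *; exact: wt_ge0.
  have -> : A = (\bigcap_i \bigcap_j
        ((fun v : 'rV[R]_N => (vec_mx v : 'M[R]_(m.+1, n.+1)) i j) @^-1` [set x | 0 <= x]))
      `&` ((\bigcap_i ((fun v : 'rV[R]_N =>
              \sum_j (vec_mx v : 'M[R]_(m.+1, n.+1)) i j) @^-1` [set wt a m (nat_of_ord i)]))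
      `&` (\bigcap_j ((fun v : 'rV[R]_N =>
              \sum_i (vec_mx v : 'M[R]_(m.+1, n.+1)) i j) @^-1` [set wt a n (nat_of_ord j)]))).
    apply/seteqP; split => v /=.
      by move=> [h1 h2 h3]; split=> [i _ j _ /=|]; [exact: h1|split=> k _ /=].
    move=> [h1 [h2 h3]]; split=> [i j|i|j]; [exact: h1|exact: h2|exact: h3].
  apply: closedI; [|apply: closedI].
  - apply: closed_bigI => i _; apply: closed_bigI => j _.
    by apply: closed_comp => [v _|]; [exact: crd|exact: closed_ge].
  - apply: closed_bigI => i _.
    by apply: closed_comp => [v _|]; [exact: ctsum|exact: closed_eq].
  - apply: closed_bigI => j _.
    by apply: closed_comp => [v _|]; [exact: ctsum|exact: closed_eq].
have cf : continuous (fun v : 'rV[R]_N =>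
    transport_cost D (vec_mx v : 'M[R]_(m.+1, n.+1))).
  apply: (ctsum) => i; apply: (ctsum) => j v.
  exact: (cvgMr_tmp (crd i j v)).
have [v /set_mem Av vmin] := compact_EVT_min A0 cA (continuous_subspaceT cf).
exists (vec_mx v) => // w wc.
have := vmin (mxvec w); rewrite mxvecK; apply.
by apply/mem_set; rewrite /A /= mxvecK.
Qed.

Lemma dval_min m n : 0 <= a <= 1 ->
  (exists2 z, couplings m n z & dval m n = transport_cost dpred z) /\
  (forall w, couplings m n w -> dval m n <= transport_cost dpred w).
Proof.
move=> a01; have [z zc zmin] := transport_cost_min dpred m n a01.
have e : dval m n = transport_cost dpred z.
  rewrite dval_rec; apply/eqP; rewrite eq_le; apply/andP; split.
    apply: ge_inf; last by exists z.
    by exists (transport_cost dpred z) => _ [w wc <-]; exact: zmin.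
  apply: lb_le_inf; first by exists (transport_cost dpred z), z.
  by move=> _ [w wc <-]; exact: zmin.
by split; [exists z|move=> w wc; rewrite e; exact: zmin].
Qed.

Definition Rval m : R := cval m m.+1 / a.

(** $S_m$; here [dpred i m.+1] is $d_{i-1,m}$. *)
Definition Sval m : R := \sum_(0 <= i < m.+1) wt a m i * (l * dpred i m.+1).

Definition lalpha : R := 1 - a + a * l.

End Bounds.

(* Main.v *)
(* Write C_ij = l * d_{i-1,j-1} and q = (1-a)^(n-m). For i <= m the mass pi_i^n
   = q * pi_i^m can stay in place at no cost, and a >= 1/2 makes it possible to
   move the remaining mass using only row m and column n. By LP duality, with
   potentials u_i = C_in and v_j = - C_jn (j <= m), v_j = C_mj - C_mn (j > m),
   this plan is optimal as soon as d satisfies the quadrangle inequality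
   d_in + d_mj <= d_ij + d_mn for i <= m <= j <= n and d_ij is nonincreasing
   in i <= j. Conversely the resulting closed formula for d propagates both
   properties: up to nonnegative terms, the defect of the quadrangle inequality
   at (m, n) is a - (1-a) + (1-a)q >= 0 times its defect for C. Finally c is computed with the product plan; the reduced costs of the
   optimal plan vanish on row m and column n, so the product plan loses at most
   (1-a)^2 * C_mn <= (1-a)^2 * lalpha^m at each step of the recursion. *)
Require Import Defs.
From mathcomp Require Import all_boot all_order all_algebra.
From mathcomp Require Import all_classical all_reals all_analysis.
From mathcomp Require Import ring lra zify.
Import Order.TTheory GRing.Theory Num.Theory.

Set Implicit Arguments.
Unset Strict Implicit.
Unset Printing Implicit Defensive.

Local Open Scope ring_scope.

(** * Sums of the weights and their one-step recursions *)

Section WeightSums.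
Context {R : realType}.
Implicit Types (a : R) (m n i : nat).

Lemma wt_expr a m n i : (i <= m <= n)%N ->
  wt a n i = (1 - a) ^+ (n - m) * wt a m i.
Proof.
move=> /andP[im /subnK <-]; rewrite addnK; elim: (n - m)%N => [|k IH].
  by rewrite add0n expr0 mul1r.
by rewrite addSn wtS ?(leq_trans im) ?leq_addl // IH mulrA -exprS.
Qed.

Lemma sum_wt_nat a m : \sum_(0 <= i < m.+1) wt a m i = 1.
Proof. by rewrite big_mkord sum_wt. Qed.

Lemma sum_wt_head a m n : (m <= n)%N ->
  \sum_(0 <= i < m.+1) wt a n i = (1 - a) ^+ (n - m).
Proof.
move=> mn; rewrite -[RHS]mulr1 -[X in _ = _ * X](sum_wt_nat a m) mulr_sumr.
apply: eq_big_nat => i im; rewrite (@wt_expr a m) //; lia.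
Qed.

Lemma sum_wt_tail a m n : (m <= n)%N ->
  \sum_(m.+1 <= j < n.+1) wt a n j = 1 - (1 - a) ^+ (n - m).
Proof.
move=> mn; have := sum_wt_nat a n.
by rewrite (@big_cat_nat _ _ _ m.+1) //= sum_wt_head //; lra.
Qed.

Lemma sum_wt_step a m (f : nat -> R) :
  \sum_(0 <= i < m.+2) wt a m.+1 i * f i =
  (1 - a) * \sum_(0 <= i < m.+1) wt a m i * f i + a * f m.+1.
Proof.
rewrite big_nat_recr //= subnn expr0 mulr1 mulr_sumr; congr (_ + _).
by apply: eq_big_nat => i im; rewrite wtS ?mulrA //; lia.
Qed.

Lemma sum_wt_tail_step a m n (f : nat -> R) : (m <= n)%N ->
  \sum_(m.+1 <= j < n.+2) wt a n.+1 j * f j =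
  (1 - a) * \sum_(m.+1 <= j < n.+1) wt a n j * f j + a * f n.+1.
Proof.
move=> mn; rewrite big_nat_recr //= subnn expr0 mulr1 mulr_sumr; congr (_ + _).
by apply: eq_big_nat => i im; rewrite wtS ?mulrA //; lia.
Qed.

(** Raising [m] by one multiplies the left side by [1 - a] and adds [a * l * lalpha l a ^+ m]. The
    powers of [lalpha l a] thus solve the recursion of $c$ with every tail mass replaced by 1. *)
Lemma sum_wt_lalpha l a m :
  wt a m 0 + \sum_(1 <= i < m.+1) wt a m i * (l * lalpha l a ^+ i.-1) =
  lalpha l a ^+ m.
Proof.
elim: m => [|m IH]; first by rewrite big_geq // addr0.
rewrite sum_wt_tail_step // wtS // addrA -mulrDr IH exprS /lalpha /=; ring.
Qed.

End WeightSums.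

Section Transport.
Context {R : realType}.
Variables (l a : R).
Hypotheses (hl : 0 < l <= 1) (ha : 2^-1 <= a <= 1).
Implicit Types (m n i j : nat).

Local Notation b := (1 - a).
Local Notation C i j := (l * dpred l a i j).

Let a01 : 0 <= a <= 1.
Proof. by have := ha; lra. Qed.

Let l_gt0 : 0 < l.
Proof. by case/andP: hl. Qed.

Let b_ge0 : 0 <= b. Proof. by have := ha; lra. Qed.
Let b_le1 : b <= 1. Proof. by have := ha; lra. Qed.

(** * Bounds on the optimal cost: potentials from below, plans from above *)

Lemma cost0S n : C 0 n.+1 = 1.
Proof. by rewrite dpred0S mulfV // gt_eqF. Qed.

(** Weak linear-programming duality: the potentials are summed against the marginals of an optimal
    plan, whose entries are nonnegative. *)
Lemma dval_dual m n (u v : nat -> R) :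
  (forall i j, (i <= m)%N -> (j <= n)%N -> u i + v j <= C i j) ->
  \sum_(0 <= i < m.+1) wt a m i * u i + \sum_(0 <= j < n.+1) wt a n j * v j
    <= dval l a m n.
Proof.
move=> uv; have [[z [z0 zr zc] ->] _] := dval_min l m n a01.
rewrite !big_mkord /transport_cost.
under eq_bigr => i _ do rewrite -zr mulr_suml.
under [X in _ + X]eq_bigr => j _ do rewrite -zc mulr_suml.
rewrite [X in _ + X]exchange_big /= -big_split /=; apply: ler_sum => i _.
rewrite -big_split /=; apply: ler_sum => j _.
by rewrite -mulrDr ler_wpM2l // uv // -ltnS.
Qed.

Lemma dpred_ge0 i j : 0 <= dpred l a i j.
Proof.
elim/ltn_ind: i j => [[|m] IH] [|n].
- by rewrite dpred00.
- by rewrite dpred0S invr_ge0 ltW.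
- by rewrite dpredS0 invr_ge0 ltW.
apply: le_trans (@dval_dual m n (fun=> 0) (fun=> 0) _) => [|i j im jn].
  by rewrite !big1 ?addr0 // => i _; rewrite mulr0.
by rewrite addr0 mulr_ge0 ?(ltW l_gt0) //; apply: IH.
Qed.

Lemma sum_nat_pick m n i (f : nat -> R) : (m <= i < n)%N ->
  \sum_(m <= j < n) (if i == j then f j else 0) = f i.
Proof.
move=> imn; rewrite (bigD1_seq i) ?mem_index_iota ?iota_uniq //= eqxx.
by rewrite big1 ?addr0 // => j /negPf; rewrite eq_sym => ->.
Qed.

(** Keeping [wt a n j] on the diagonal leaves the fraction [1 - b ^+ (n - m)] of each row to [y].
    Zero diagonal cost is a hypothesis so that the lemma can serve in the induction that proves
    [dpred_diag]. *)
Lemma dval_le_offdiag m n (y : nat -> nat -> R) : (m <= n)%N ->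
    (forall i, (i <= m)%N -> dpred l a i i = 0) ->
    (forall i j, (i <= m)%N -> (m < j <= n)%N -> 0 <= y i j) ->
    (forall i, (i <= m)%N ->
       \sum_(m.+1 <= j < n.+1) y i j = (1 - b ^+ (n - m)) * wt a m i) ->
    (forall j, (m < j <= n)%N -> \sum_(0 <= i < m.+1) y i j = wt a n j) ->
  dval l a m n <= \sum_(0 <= i < m.+1) \sum_(m.+1 <= j < n.+1) y i j * C i j.
Proof.
move=> mn d0 y0 yr yc; have [_ dmin] := dval_min l m n a01.
pose f i j := if (j <= m)%N then (if i == j then wt a n j else 0) else y i j.
pose z : 'M[R]_(m.+1, n.+1) := \matrix_(i, j) f i j.
have splitn (g : nat -> R) : \sum_(j < n.+1) g j =
    \sum_(0 <= j < m.+1) g j + \sum_(m.+1 <= j < n.+1) g j.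
  by rewrite -(big_mkord xpredT g) (@big_cat_nat _ _ _ m.+1).
have zc : couplings a z.
  split=> [i j|i|j].
  - rewrite mxE /f; have := ltn_ord i; have := ltn_ord j.
    case: (leqP j m) => [jm|mj] ? ?; last by apply: y0; rewrite ?mj -ltnS.
    by case: ifP => // _; rewrite wt_ge0.
  - under eq_bigr do rewrite mxE.
    have im : (i <= m)%N by rewrite -ltnS.
    rewrite (splitn (f i)).
    transitivity (wt a n i + (1 - b ^+ (n - m)) * wt a m i); last first.
      by rewrite (@wt_expr _ a m n) ?im //; ring.
    congr (_ + _).
      rewrite -(@sum_nat_pick 0 m.+1 i (wt a n)) //.
      by apply: eq_big_nat => j jm; rewrite /f (_ : (j <= m)%N) //; lia.
    rewrite -yr //.
    by apply: eq_big_nat => j jm; rewrite /f leqNgt (_ : (m < j)%N) //; lia.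
  - under eq_bigr do rewrite mxE.
    rewrite -(big_mkord xpredT (fun i => f i j)) /f.
    have := ltn_ord j; case: (leqP j m) => [jm|mj] ?; last by rewrite yc // mj -ltnS.
    under eq_bigr do rewrite eq_sym.
    by rewrite (sum_nat_pick (fun=> wt a n j)).
apply: le_trans (dmin _ zc) _; rewrite /transport_cost.
rewrite big_mkord; apply: ler_sum => i _.
under eq_bigr do rewrite mxE.
rewrite (splitn (fun j => f i j * C i j)) /f big_nat_cond big1 ?add0r.
  rewrite le_eqVlt; apply/orP; left; apply/eqP/eq_big_nat => j jm.
  by rewrite leqNgt (_ : (m < j)%N) //; lia.
move=> j; rewrite andbT => jm; rewrite (_ : (j <= m)%N); last lia.
by case: eqP => [->|_]; rewrite ?mul0r // d0 ?mulr0 //; lia.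
Qed.

Lemma dpred_diag i : dpred l a i i = 0.
Proof.
elim/ltn_ind: i => -[|m] IH; first by rewrite dpred00.
apply/eqP; rewrite eq_le dpred_ge0 andbT.
apply: le_trans (@dval_le_offdiag m m (fun _ _ => 0) _ IH _ _ _) _ => //.
- by move=> i _; rewrite big_geq // subnn expr0 subrr mul0r.
- by move=> j; lia.
- by rewrite big1 // => i _; rewrite big_geq.
Qed.

(* The cost of the plan which keeps as much mass as possible in place and
   otherwise only uses row [m] and column [n]. *)
Definition nested_cost m n : R :=
  (1 - b ^+ (n - m)) * (\sum_(0 <= i < m.+1) wt a m i * C i n - C m n)
  + \sum_(m.+1 <= j < n.+1) wt a n j * C m j.

Lemma nested_cost_diag n : nested_cost n n = 0.
Proof. by rewrite /nested_cost subnn expr0 subrr mul0r big_geq // addr0. Qed.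

Lemma dval_le_nested_cost m n : (m < n)%N -> dval l a m n <= nested_cost m n.
Proof.
move=> mn; have mn' := ltnW mn; set q := b ^+ (n - m).
have q1 : 0 <= 1 - q by rewrite subr_ge0 exprn_ile1.
(* Each row sends its surplus to column [n], while row [m] fills every column beyond [m];
   subtracting [1 - q] at the corner [(m, n)] restores both marginals. *)
pose y i j := (if n == j then (1 - q) * wt a m i else 0)
  + (if m == i then wt a n j - (if n == j then 1 - q else 0) else 0).
have -> : nested_cost m n =
    \sum_(0 <= i < m.+1) \sum_(m.+1 <= j < n.+1) y i j * C i j.
  pose g i j := (if n == j then (1 - q) * (wt a m i * C i j) else 0)
    + (if m == i then wt a n j * C m j - (if n == j then (1 - q) * C m j else 0)
       else 0).
  transitivity (\sum_(0 <= i < m.+1) \sum_(m.+1 <= j < n.+1) g i j).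
    under eq_bigr do rewrite big_split /= sum_nat_pick ?mn ?leqnn //.
    rewrite big_split /= -mulr_sumr.
    rewrite [X in _ = _ + X]exchange_big /=.
    under [X in _ = _ + X]eq_bigr do rewrite
      (sum_nat_pick (fun=> wt a n _ * _ - _)) ?leqnn //.
    rewrite sumrB sum_nat_pick ?mn ?leqnn // /nested_cost -/q; ring.
  apply: eq_bigr => i _; apply: eq_bigr => j _; rewrite /g /y.
  by case: eqP => [<-|_]; case: eqP => [<-|_]; ring.
apply: dval_le_offdiag => //.
- by move=> i _; rewrite dpred_diag.
- move=> i j im jn; rewrite /y.
  have w0 k p : 0 <= wt a k p by rewrite wt_ge0.
  case: eqP => [<-|_]; case: eqP => [mi|_]; rewrite -?mi ?addr0 ?add0r ?subr0 //.
    (* The corner entry is [a] if [m = 0] and [2a - 1 + (1 - a) q] otherwise; its sign is where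
       [a >= 1/2] enters. *)
    have wmm k : (0 < k)%N -> wt a k k = a by case: k => // k; rewrite /= subnn mulr1.
    rewrite (wmm n); last lia.
    have [->|m0] := posnP m.
      by rewrite /= mulr1; have := ha; lra.
    have q0 : 0 <= q by rewrite exprn_ge0.
    have : 0 <= b * q by rewrite mulr_ge0.
    by rewrite wmm //; have := ha; nra.
  by rewrite mulr_ge0.
- move=> i im; rewrite /y big_split /= sum_nat_pick ?mn ?leqnn //.
  case: eqP => [<-|_]; last by rewrite big1_eq addr0.
  by rewrite sumrB sum_nat_pick ?mn ?leqnn // sum_wt_tail // subrr addr0.
move=> j jn; rewrite /y big_split /= sum_nat_pick ?leqnn //.
case: eqP => [_|_]; last by rewrite big1 // add0r subr0.
by rewrite -mulr_sumr sum_wt_nat; ring.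
Qed.

(** * Quadrangle inequality, monotonicity and the closed formula for $d$ *)

Definition quadrangle_upto N := forall i j, (i < j < N)%N ->
  dpred l a i j.+1 + dpred l a i.+1 j <= dpred l a i j + dpred l a i.+1 j.+1.

Definition antitone_upto N := forall i j, (i < j <= N)%N ->
  dpred l a i.+1 j <= dpred l a i j.

(** The inequality on a rectangle is the sum of those on its unit squares: [Q1] adds up columns, the
    outer induction rows. The condition [m <= j] keeps all squares on or above the diagonal. *)
Lemma quadrangle_leq N i m j n : quadrangle_upto N ->
    (i <= m <= j)%N -> (j <= n <= N)%N ->
  dpred l a i n + dpred l a m j <= dpred l a i j + dpred l a m n.
Proof.
move=> Q; have Q1 i' j' n' : (i' < j')%N -> (j' <= n' <= N)%N ->
    dpred l a i' n' + dpred l a i'.+1 j' <= dpred l a i' j' + dpred l a i'.+1 n'.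
  move=> ij; elim: n' => [|p IH]; first by case: j' ij.
  case/andP; rewrite leq_eqVlt => /predU1P[-> //|jp pN].
  have IHp := IH ltac:(lia).
  have Qp : (i' < p < N)%N by lia.
  have := Q _ _ Qp; lra.
elim: m => [|m IH]; first by rewrite leqn0 => /andP[/eqP ->] *; lra.
case/andP; rewrite leq_eqVlt => /predU1P[->|im mj jn]; first by move=> *; lra.
have := IH ltac:(lia) jn; have := Q1 m j n mj jn; lra.
Qed.

Lemma antitone_leq N i m j : antitone_upto N ->
  (i <= m <= j)%N -> (j <= N)%N -> dpred l a m j <= dpred l a i j.
Proof.
move=> M imj jN; elim: m imj => [|m IH]; first by rewrite leqn0 => /andP[/eqP ->].
case/andP; rewrite leq_eqVlt => /predU1P[-> //|im mj].
by apply: le_trans (M m j ltac:(lia)) (IH ltac:(lia)).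
Qed.

Lemma nested_cost_le_dval m n : quadrangle_upto n -> antitone_upto n ->
  (m <= n)%N -> nested_cost m n <= dval l a m n.
Proof.
move=> Q M mn.
pose v j := if (j <= m)%N then - C j n else C m j - C m n.
apply: le_trans (@dval_dual m n (fun i => C i n) v _).
  rewrite (@big_cat_nat _ _ _ m.+1 0 n.+1) //=.
  rewrite [X in _ + (X + _)](@eq_big_nat _ _ _ 0 m.+1 _
    (fun j => - (b ^+ (n - m) * (wt a m j * C j n)))); last first.
    by move=> j jm; rewrite /v (_ : (j <= m)%N) ?(@wt_expr _ a m n); [ring|lia..].
  rewrite (@eq_big_nat _ _ _ m.+1 n.+1 _
    (fun j => wt a n j * C m j - wt a n j * C m n)); last first.
    by move=> j jm; rewrite /v leqNgt (_ : (m < j)%N) ?mulrBr //; lia.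
  rewrite sumrN -mulr_sumr sumrB -mulr_suml sum_wt_tail // /nested_cost.
  by rewrite le_eqVlt; apply/orP; left; apply/eqP; ring.
(* Dual feasibility. For [i <= j <= m] it is the quadrangle inequality with the zero entry [(j, j)];
   for [j < i], monotonicity and nonnegativity suffice; for [j > m] it is the quadrangle inequality
   with rows [i], [m] and columns [j], [n]. *)
move=> i j im jn; rewrite /v; case: (leqP j m) => [jm|mj].
  rewrite -mulrBr ler_pM2l // lerBlDr.
  case: (leqP i j) => ij.
    by have := @quadrangle_leq n i j j n Q; rewrite dpred_diag addr0; apply; lia.
  have := @antitone_leq n j i n M ltac:(lia) (leqnn n).
  by have := dpred_ge0 i j; lra.
rewrite -mulrBr -mulrDr ler_pM2l //.
have := @quadrangle_leq n i m j n Q; rewrite im jn ltnW // leqnn => /(_ isT isT).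
lra.
Qed.

(** The zero diagonal entry at [m.+1] lets the tail sum range over the same columns as in
    [nested_cost m n], so that the two can be compared. *)
Lemma nested_costS_first m n : (m < n)%N ->
  nested_cost m.+1 n =
  (b - b ^+ (n - m)) * (\sum_(0 <= i < m.+1) wt a m i * C i n - C m.+1 n)
  + \sum_(m.+1 <= j < n.+1) wt a n j * C m.+1 j.
Proof.
move=> mn; rewrite /nested_cost sum_wt_step [X in _ = _ + X]big_ltn ?ltnS //.
by rewrite dpred_diag !mulr0 add0r -[in RHS](subnSK mn) exprS; ring.
Qed.

Lemma nested_costS_second m n : (m <= n)%N ->
  nested_cost m n.+1 =
  (1 - b * b ^+ (n - m)) *
    (\sum_(0 <= i < m.+1) wt a m i * C i n.+1 - C m n.+1)
  + b * (\sum_(m.+1 <= j < n.+1) wt a n j * C m j) + a * C m n.+1.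
Proof.
by move=> mn; rewrite /nested_cost sum_wt_tail_step // subSn // exprS addrA.
Qed.

(** Among the columns up to [n], the drop from row [m] to row [m.+1] is smallest at [n]. *)
Lemma sum_tail_cost_diff m n : quadrangle_upto n -> (m < n)%N ->
  (1 - b ^+ (n - m)) * (C m n - C m.+1 n) <=
  \sum_(m.+1 <= j < n.+1) wt a n j * C m j
  - \sum_(m.+1 <= j < n.+1) wt a n j * C m.+1 j.
Proof.
move=> Q mn; rewrite -sumrB -sum_wt_tail ?(ltnW mn) // mulr_suml.
apply: ler_sum_nat => j jn; rewrite -[leRHS]mulrBr ler_wpM2l ?wt_ge0 //.
rewrite -!mulrBr ler_pM2l //.
have := @quadrangle_leq n m m.+1 j n Q ltac:(lia) ltac:(lia); lra.
Qed.

(** Among the rows up to [m], the increase from column [n] to column [n.+1] is largest at [m]. *)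
Lemma sum_head_cost_diff m n : quadrangle_upto n.+1 -> (m <= n)%N ->
  \sum_(0 <= i < m.+1) wt a m i * C i n.+1
  - \sum_(0 <= i < m.+1) wt a m i * C i n <= C m n.+1 - C m n.
Proof.
move=> Q mn; rewrite -sumrB -[leRHS]mul1r -(sum_wt_nat a m) mulr_suml.
apply: ler_sum_nat => i im; rewrite -[leLHS]mulrBr ler_wpM2l ?wt_ge0 //.
rewrite -!mulrBr ler_pM2l //.
have := @quadrangle_leq n.+1 i m n n.+1 Q ltac:(lia) ltac:(lia); lra.
Qed.

Lemma nested_cost_quadrangle m n : quadrangle_upto n.+1 -> (m < n)%N ->
  nested_cost m n.+1 + nested_cost m.+1 n <=
  nested_cost m n + nested_cost m.+1 n.+1.
Proof.
move=> Q mn; have mn' := ltnW mn.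
have Qn : quadrangle_upto n by move=> i j ij; apply: Q; lia.
have := sum_tail_cost_diff Qn mn; have := sum_head_cost_diff Q mn'.
rewrite (nested_costS_first mn) (nested_costS_first (ltnW _ : m < n.+1)%N) //.
rewrite (nested_costS_second mn') sum_wt_tail_step // /nested_cost subSn //.
rewrite exprS; set q := b ^+ (n - m).
have q0 : 0 <= b * q by rewrite mulr_ge0 ?exprn_ge0.
have D0 : 0 <= C m n + C m.+1 n.+1 - C m n.+1 - C m.+1 n.
  have := @quadrangle_leq n.+1 m m.+1 n n.+1 Q ltac:(lia) ltac:(lia).
  by rewrite -!mulrDr -!mulrBr => ?; rewrite mulr_ge0 ?(ltW l_gt0) //; lra.
set A' := \sum_(0 <= i < _) _; set A := \sum_(0 <= i < _) _.
set X := \sum_(_ <= j < _) _; set Y := \sum_(_ <= j < _) _.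
move=> hA hX; rewrite -subr_ge0.
set E := (X in 0 <= X).
(* The first two terms are the slacks [hA] and [hX]; the third is the defect of [C] on one unit
   square, with a coefficient made nonnegative by [a >= 1/2]. *)
have -> : E = a * ((C m n.+1 - C m n) - (A' - A))
    + a * (X - Y - (1 - q) * (C m n - C m.+1 n))
    + (a - b + b * q) * (C m n + C m.+1 n.+1 - C m n.+1 - C m.+1 n).
  by rewrite /E; ring.
have a0 : 0 <= a by case/andP: a01.
apply: addr_ge0; first by rewrite addr_ge0 // mulr_ge0 // subr_ge0.
by rewrite mulr_ge0 //; have := ha; lra.
Qed.

Lemma nested_cost_antitone m n :
    quadrangle_upto n -> antitone_upto n -> (m < n)%N ->
  nested_cost m.+1 n <= nested_cost m n.
Proof.
move=> Q M mn; have := sum_tail_cost_diff Q mn.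
have : C m.+1 n <= \sum_(0 <= i < m.+1) wt a m i * C i n.
  rewrite -[leLHS]mul1r -(sum_wt_nat a m) mulr_suml.
  apply: ler_sum_nat => i im; rewrite ler_wpM2l ?wt_ge0 // ler_pM2l //.
  by apply: antitone_leq M _ (leqnn n); lia.
rewrite nested_costS_first // /nested_cost => hA hX.
(* The difference of the two nested costs is exactly this term plus the slack in [hX]. *)
have : 0 <= a * (\sum_(0 <= i < m.+1) wt a m i * C i n - C m.+1 n).
  by rewrite mulr_ge0 ?subr_ge0 //; case/andP: a01.
by nra.
Qed.

(** Since [dval m n] is [dpred] at indices shifted by one, the properties up to [N] give the closed
    formula for [n <= N], which covers [dpred] up to [N.+1] except its row 0. *)
Lemma dpred_quadrangle_antitone N : quadrangle_upto N /\ antitone_upto N.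
Proof.
elim: N => [|N [Q M]]; first by split=> i j; lia.
have dE m n : (m <= n <= N)%N -> dval l a m n = nested_cost m n.
  case/andP; rewrite leq_eqVlt => /predU1P[-> _|mn nN].
    by rewrite nested_cost_diag /dval dpred_diag.
  apply/eqP; rewrite eq_le dval_le_nested_cost //= nested_cost_le_dval ?(ltnW mn) //.
    by move=> i j ij; apply: Q; lia.
  by move=> i j ij; apply: M; lia.
(* Row 0 encodes $d_{-1,n}$, constant equal to $1/\ell$; it has to be compared with $d_{0,n}$ by
   hand. *)
have d0E n : (n <= N)%N -> dpred l a 1 n.+1 = 1 - b ^+ n.
  case: n => [|n] nN; first by rewrite dpred_diag expr0 subrr.
  rewrite [LHS](dE 0 n.+1) // /nested_cost big_nat1 /= expr0 mul1r subrr mulr0.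
  rewrite add0r -(sum_wt_tail a (leq0n n.+1)); apply: eq_big_nat => -[//|j] _.
  by rewrite cost0S mulr1.
split.
  move=> [|m] [|n] // mnN.
    rewrite !dpred0S !d0E ?lerD2l; [|lia..].
    by rewrite lerN2 exprS ler_piMl ?exprn_ge0.
  rewrite -!/(dval _ _ _ _) !dE; [|lia..].
  by apply: nested_cost_quadrangle; [move=> i j ij; apply: Q; lia|lia].
move=> [|m] [|n] // mnN.
  rewrite dpred0S d0E; last lia.
  have : 1 <= l^-1 by rewrite invf_ge1 //; case/andP: hl.
  by have := exprn_ge0 n b_ge0; lra.
rewrite -!/(dval _ _ _ _) !dE; [|lia..].
by apply: nested_cost_antitone; [move=> i j ij; apply: Q; lia|
  move=> i j ij; apply: M; lia|lia].
Qed.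

Lemma dvalE m n : (m <= n)%N -> dval l a m n = nested_cost m n.
Proof.
rewrite leq_eqVlt => /predU1P[->|mn].
  by rewrite nested_cost_diag /dval dpred_diag.
have [Q M] := dpred_quadrangle_antitone n.
by apply/eqP; rewrite eq_le dval_le_nested_cost //= nested_cost_le_dval // ltnW.
Qed.

(** Quadrangle inequality against row 0, which is constant except for its entry at column 0; hence
    [0 < j]. *)
Lemma dpred_homo_second i j n : (0 < j)%N -> (i <= j <= n)%N ->
  dpred l a i j <= dpred l a i n.
Proof.
move=> j0 ijn; have [Q _] := dpred_quadrangle_antitone n.
have := @quadrangle_leq n 0 i j n Q ltac:(lia) ltac:(lia).
case: j n j0 ijn {Q} => // j [|n]; first by lia.
by rewrite !dpred0S lerD2l.
Qed.

(** * Comparison of $c$ and $d$ through the product plan *)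

Lemma dval_le_product_cost m n : (m <= n)%N ->
  dval l a m n <= \sum_(0 <= i < m.+1) \sum_(m.+1 <= j < n.+1)
    wt a m i * wt a n j * C i j.
Proof.
(* The common mass stays in place and the rest is coupled independently. *)
move=> mn; apply: dval_le_offdiag => //.
- by move=> i _; rewrite dpred_diag.
- by move=> i j _ _; rewrite mulr_ge0 ?wt_ge0.
- by move=> i _; rewrite -mulr_sumr sum_wt_tail // mulrC.
- by move=> j _; rewrite -mulr_suml sum_wt_nat mul1r.
Qed.

(* [l * c_{i-1,j-1}], with [c_{-1,j} = 1 / l] *)
Definition cval_cost i j : R := if i is i'.+1 then l * cval l a i' j.-1 else 1.

(** The term $\pi_0^m-\pi_0^n$ of the recursion is row 0 at unit cost: $\pi_0^m$ times the tail
    mass. *)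
Lemma cval_product_cost m n : (m <= n)%N ->
  cval l a m n = \sum_(0 <= i < m.+1) \sum_(m.+1 <= j < n.+1)
    wt a m i * wt a n j * cval_cost i j.
Proof.
move=> mn; rewrite cval_rec [RHS]big_ltn //; congr (_ + _).
  rewrite (@wt_expr _ a m n 0) ?leq0n //.
  under eq_bigr do rewrite mulr1.
  by rewrite -mulr_sumr sum_wt_tail //; ring.
apply: eq_big_nat => -[//|i] _; apply: eq_bigr => j _ /=; ring.
Qed.

Definition lalpha_cost i : R := if i is i'.+1 then l * lalpha l a ^+ i' else 1.

Lemma sum_lalpha_cost m :
  \sum_(0 <= i < m.+1) wt a m i * lalpha_cost i = lalpha l a ^+ m.
Proof.
rewrite -sum_wt_lalpha big_ltn // mulr1; congr (_ + _).
by apply: eq_big_nat => -[].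
Qed.

Lemma lalpha_ge0 : 0 <= lalpha l a.
Proof. by rewrite /lalpha; have := ha; have := hl; nra. Qed.

Lemma lalpha_cost_ge0 i : 0 <= lalpha_cost i.
Proof.
by case: i => [|i] //=; rewrite mulr_ge0 ?(ltW l_gt0) ?exprn_ge0 ?lalpha_ge0.
Qed.

Lemma sum_wt_tail_le1 m n : (m <= n)%N ->
  0 <= \sum_(m.+1 <= j < n.+1) wt a n j <= 1.
Proof.
move=> mn; rewrite sum_wt_tail // subr_ge0 exprn_ile1 //=.
by rewrite gerBl exprn_ge0.
Qed.

(** The bound on [f] does not depend on [j], so the tail mass is estimated by 1. It serves with
    [k = 1] to bound $c$ and with [k = b ^+ 2 * m%:R] to propagate the error. *)
Lemma product_cost_le_lalpha m n (f : nat -> nat -> R) (k : R) : (m <= n)%N ->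
    0 <= k ->
    (forall i j, (i <= m)%N -> (m < j <= n)%N -> f i j <= k * lalpha_cost i) ->
  \sum_(0 <= i < m.+1) \sum_(m.+1 <= j < n.+1) wt a m i * wt a n j * f i j
    <= k * lalpha l a ^+ m.
Proof.
move=> mn k0 fk; rewrite -sum_lalpha_cost mulr_sumr.
apply: ler_sum_nat => i im; have /andP[t0 t1] := sum_wt_tail_le1 mn.
have ck : 0 <= k * lalpha_cost i by rewrite mulr_ge0 ?lalpha_cost_ge0.
apply: (@le_trans _ _ (\sum_(m.+1 <= j < n.+1)
    wt a n j * (wt a m i * (k * lalpha_cost i)))).
  apply: ler_sum_nat => j jn; rewrite -mulrA mulrCA.
  by rewrite !ler_wpM2l ?wt_ge0 // fk; lia.
by rewrite -mulr_suml [leRHS]mulrCA ler_piMl ?mulr_ge0 ?wt_ge0 ?lalpha_cost_ge0.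
Qed.

Lemma cval_le_lalpha m n : (m <= n)%N -> cval l a m n <= lalpha l a ^+ m.
Proof.
elim/ltn_ind: m n => m IH n mn; rewrite cval_product_cost // -[leRHS]mul1r.
apply: product_cost_le_lalpha => // -[|i] j im jn; rewrite mul1r //=.
by rewrite ler_pM2l // IH //; lia.
Qed.

(** The product plan is admissible for $d$, and by induction its entries cost no more than those
    used for $c$. *)
Lemma dval_le_cval m n : (m <= n)%N -> dval l a m n <= cval l a m n.
Proof.
elim/ltn_ind: m n => m IH n mn; rewrite cval_product_cost //.
apply: le_trans (dval_le_product_cost mn) _.
apply: ler_sum_nat => i im; apply: ler_sum_nat => -[//|j] jn.
apply: ler_wpM2l; first by apply: mulr_ge0; apply: wt_ge0.
case: i im => [|i] im; first by rewrite cost0S.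
by rewrite ler_pM2l //; apply: IH; lia.
Qed.

Lemma cost_le_lalpha m n : (m < n)%N -> C m n <= lalpha l a ^+ m.
Proof.
case: m n => [|m] [|n] // mn; first by rewrite cost0S.
rewrite exprS; apply: ler_pM; rewrite ?dpred_ge0 ?(ltW l_gt0) //.
  (* Here [lalpha l a - l = (1 - a) * (1 - l)]. *)
  by rewrite /lalpha; have := ha; have := hl; nra.
by apply: le_trans (dval_le_cval _) (cval_le_lalpha _); rewrite ltnW.
Qed.

(* The reduced cost [s i j] vanishes on row [m] and on column [n], so that only a mass of at
   most [(1 - a) ^+ 2] contributes. *)
Lemma product_cost_sub_dval m n : (m < n)%N ->
  \sum_(0 <= i < m.+1) \sum_(m.+1 <= j < n.+1) wt a m i * wt a n j * C i j
    - dval l a m n <= b ^+ 2 * lalpha l a ^+ m.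
Proof.
move=> mn; have mn' := ltnW mn.
pose s i j := C i j - C i n + C m n - C m j.
have -> : \sum_(0 <= i < m.+1) \sum_(m.+1 <= j < n.+1) wt a m i * wt a n j * C i j
    - dval l a m n =
    \sum_(0 <= i < m.+1) wt a m i * \sum_(m.+1 <= j < n.+1) wt a n j * s i j.
  pose X := \sum_(m.+1 <= j < n.+1) wt a n j * C m j.
  pose q := b ^+ (n - m).
  transitivity (\sum_(0 <= i < m.+1) (wt a m i *
      (\sum_(m.+1 <= j < n.+1) wt a n j * C i j)
      - (1 - q) * (wt a m i * C i n) + ((1 - q) * C m n - X) * wt a m i)).
    rewrite big_split sumrB /= -!mulr_sumr sum_wt_nat dvalE // /nested_cost -/q -/X.
    under eq_bigr do (under eq_bigr do rewrite -mulrA; rewrite -mulr_sumr).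
    by ring.
  apply: eq_bigr => i _.
  have -> : \sum_(m.+1 <= j < n.+1) wt a n j * s i j =
    \sum_(m.+1 <= j < n.+1) wt a n j * C i j + (1 - q) * (C m n - C i n) - X.
    rewrite -sum_wt_tail // mulr_suml -big_split -sumrB /=.
    by apply: eq_bigr => j _; rewrite /s; ring.
  by ring.
have L0 : 0 <= lalpha l a ^+ m by rewrite exprn_ge0 ?lalpha_ge0.
(* In fact [s i j <= C m n], because costs grow along a row and are nonnegative. *)
have sle i j : (i <= m)%N -> (m < j <= n)%N -> s i j <= lalpha l a ^+ m.
  move=> im jn; have := cost_le_lalpha mn.
  have : C i j <= C i n by rewrite ler_pM2l // dpred_homo_second //; lia.
  have : 0 <= C m j by rewrite mulr_ge0 ?dpred_ge0 ?(ltW l_gt0).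
  by rewrite /s; lra.
(* Row [m] and column [n] each carry weight at least [a], leaving at most [1 - a] in each factor. It
   is an inequality since [wt a 0 0 = 1]. *)
have wmm k : a <= wt a k k.
  by case: k => [|k] /=; rewrite ?subnn expr0 ?mulr1 //; case/andP: a01.
rewrite big_nat_recr //= [X in _ + _ * X]big1 => [|j _]; last first.
  by rewrite /s; ring.
rewrite mulr0 addr0 expr2 -mulrA.
have hrow i : (i < m)%N ->
    \sum_(m.+1 <= j < n.+1) wt a n j * s i j <= b * lalpha l a ^+ m.
  move=> im; rewrite big_nat_recr //= (_ : s i n = 0); last by rewrite /s; ring.
  rewrite mulr0 addr0.
  apply: (@le_trans _ _ (\sum_(m.+1 <= j < n) wt a n j * lalpha l a ^+ m)).
    by apply: ler_sum_nat => j jn; rewrite ler_wpM2l ?wt_ge0 ?sle //; lia.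
  rewrite -mulr_suml ler_wpM2r //.
  have /andP[_] := sum_wt_tail_le1 mn'; rewrite big_nat_recr //=.
  by have := wmm n; lra.
apply: (@le_trans _ _ (\sum_(0 <= i < m) wt a m i * (b * lalpha l a ^+ m))).
  by apply: ler_sum_nat => i im; rewrite ler_wpM2l ?wt_ge0 ?hrow.
rewrite -mulr_suml ler_wpM2r ?mulr_ge0 //.
by have := sum_wt_nat a m; rewrite big_nat_recr //=; have := wmm m; lra.
Qed.

(** Using the product plan once costs [b ^+ 2 * lalpha l a ^+ m]. The errors inherited from smaller
    indices have factor at most [m] and vanish on row 0, so averaging them gives the remaining [m]
    units. *)
Lemma cval_sub_dval_le m n : (m < n)%N ->
  cval l a m n - dval l a m n <= b ^+ 2 * m.+1%:R * lalpha l a ^+ m.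
Proof.
elim/ltn_ind: m n => m IH n mn.
have := product_cost_sub_dval mn; rewrite cval_product_cost ?(ltnW mn) //.
set S := \sum_(0 <= i < _) _; set T := \sum_(0 <= i < _) _ => hS.
have : T - S <= b ^+ 2 * m%:R * lalpha l a ^+ m.
  rewrite /T /S -sumrB; under eq_bigr do rewrite -sumrB.
  under eq_bigr do under eq_bigr do rewrite -mulrBr.
  apply: (@product_cost_le_lalpha m n (fun i j => cval_cost i j - C i j)).
  - exact: ltnW.
  - by rewrite mulr_ge0 ?exprn_ge0 ?ler0n.
  move=> [|i] [|j] // im jn.
    by rewrite cost0S subrr mulr1 mulr_ge0 ?exprn_ge0 ?ler0n.
  rewrite /= -mulrBr mulrCA ler_pM2l //.
  apply: le_trans (IH i im j _) _; first lia.
  by rewrite ler_wpM2r ?exprn_ge0 ?lalpha_ge0 // ler_wpM2l ?exprn_ge0 // ler_nat.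
by rewrite -natr1; lra.
Qed.

(** * The case $n=m+1$ *)

Lemma sval_split m : Sval l a m =
  wt a m 0 + \sum_(1 <= i < m.+1) wt a m i * (l * dpred l a i m.+1).
Proof. by rewrite /Sval big_ltn // cost0S mulr1. Qed.

(** The tail is the single column [m.+1] of weight [a], and its cost cancels the term subtracted in
    [nested_cost]. *)
Lemma dval_succ m : dval l a m m.+1 = a * Sval l a m.
Proof.
rewrite dvalE // /nested_cost big_nat1 subSnn expr1 [wt a m.+1 m.+1]/=.
by rewrite subnn expr0 /Sval; ring.
Qed.

End Transport.

Theorem proposition20 (R : realType) (l a : R)
    (hl : 0 < l <= 1) (ha : 2^-1 <= a <= 1) :
  (forall m n : nat, (m < n)%N ->
     0 <= cval l a m n - dval l a m n
       <= (1 - a) ^+ 2 * (m.+1)%:R * lalpha l a ^+ m) /\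
  (forall m : nat,
     [/\ dval l a m m.+1 =
           a * (wt a m 0 + \sum_(1 <= i < m.+1) wt a m i * (l * dpred l a i m.+1)),
         dval l a m m.+1 = a * Sval l a m
       & Rval l a m - Sval l a m
           <= (1 - a) ^+ 2 * (m.+1)%:R * lalpha l a ^+ m / a]).
Proof.
have H m n : (m < n)%N -> 0 <= cval l a m n - dval l a m n
    <= (1 - a) ^+ 2 * (m.+1)%:R * lalpha l a ^+ m.
  by move=> mn; rewrite subr_ge0 dval_le_cval ?cval_sub_dval_le // ltnW.
split=> // m; split; [by rewrite -sval_split // dval_succ|exact: dval_succ|].
have a0 : 0 < a by lra.
have -> : Rval l a m - Sval l a m = (cval l a m m.+1 - dval l a m m.+1) / a.
  by rewrite dval_succ // /Rval; field; rewrite gt_eqF.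
by rewrite ler_pM2r ?invr_gt0 //; case/andP: (H m m.+1 (ltnSn m)).
Qed.
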